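(* If $\rho$ is an $(L,A)$-quasi-action of a group $G$ on an arbitrary metric space $X$, then $\rho$ is $(L,3A)$-quasi-conjugate to a canonically defined isometric action of $G$ on a metric space $X'$.
   Context: For $L\ge 1$, $A\ge 0$, a map $f:Z\to Z'$ of metric spaces is an $(L,A)$-quasi-isometry if $\frac1L d(x,y)-A\le d(f(x),f(y))\le L\,d(x,y)+A$ for all $x,y\in Z$ and every point of $Z'$ is within distance $A$ of $f(Z)$. An $(L,A)$-quasi-action of a group $G$ on a metric space $Z$ is a map $\rho:G\times Z\to Z$, written $\rho(g)=\rho(g,\cdot)$, such that each $\rho(g)$ is an $(L,A)$-quasi-isometry, and $d(\rho(g_1)\rho(g_2)z,\rho(g_1g_2)z)\le A$ and $d(\rho(e)z,z)\le A$ for all $g_1,g_2\in G$, $z\in Z$. An isometric action is in particular a quasi-action. A quasi-action $\rho$ of $G$ on $Z$ is quasi-conjugate to a quasi-action $\rho'$ of $G$ on $Z'$ if there is a quasi-isometry $\phi:Z\to Z'$ with $\sup_{g\in G,\,z\in Z}d(\phi(\rho(g)z),\rho'(g)\phi(z))<\infty$; it is $(L,C)$-quasi-conjugate if $\phi$ can be taken to be an $(L,C)$-quasi-isometry. *)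

(* Defs.v *)
From HB Require Import structures.
From mathcomp Require Import all_boot all_order all_algebra.
From mathcomp Require Import all_classical all_reals all_analysis.

Set Implicit Arguments.
Unset Strict Implicit.
Unset Printing Implicit Defensive.

Import Order.TTheory GRing.Theory Num.Theory.

Local Open Scope ring_scope.

Definition quasi_isometry (R : realType) (Z Z' : metricType R) (L A : R)
    (f : Z -> Z') : Prop :=
  [/\ 1 <= L, 0 <= A,
      forall x y, L^-1 * mdist x y - A <= mdist (f x) (f y),
      forall x y, mdist (f x) (f y) <= L * mdist x y + A &
      forall z', exists z, mdist z' (f z) <= A].

Definition quasi_action (R : realType) (G : groupType) (Z : metricType R)
    (L A : R) (rho : G -> Z -> Z) : Prop :=
  [/\ forall g, quasi_isometry L A (rho g),
      forall g h z, mdist (rho g (rho h z)) (rho (g * h)%g z) <= A &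
      forall z, mdist (rho 1%g z) z <= A].

(* A distance-preserving action; surjectivity of each [rho g] follows from the
   two action axioms. *)
Definition isometric_action (R : realType) (G : groupType) (Z : metricType R)
    (rho : G -> Z -> Z) : Prop :=
  [/\ forall g x y, mdist (rho g x) (rho g y) = mdist x y,
      forall g h z, rho g (rho h z) = rho (g * h)%g z &
      forall z, rho 1%g z = z].

Definition quasi_conjugate (R : realType) (G : groupType) (Z Z' : metricType R)
    (L C : R) (rho : G -> Z -> Z) (rho' : G -> Z' -> Z') : Prop :=
  exists2 phi : Z -> Z', quasi_isometry L C phi &
    exists D : R, forall g z, mdist (phi (rho g z)) (rho' g (phi z)) <= D.

(* Being a quasi-action is a property of the map, so the constants are not part
   of the data. *)
Record quasiAction (R : realType) := QuasiAction {
  qa_group : groupType;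
  qa_space : metricType R;
  qa_map : qa_group -> qa_space -> qa_space;
  qa_mapP : exists L A : R, quasi_action L A qa_map }.

Definition qa_isomorphism (R : realType) (q r : quasiAction R)
    (alpha : qa_group q -> qa_group r) (beta : qa_space q -> qa_space r) :
    Prop :=
  [/\ bijective alpha, {morph alpha : g h / (g * h)%g},
      bijective beta, forall x y, mdist (beta x) (beta y) = mdist x y &
      forall g x, beta (qa_map g x) = qa_map (alpha g) (beta x)].

(* A canonical way of attaching to each quasi-action an isometric action of the
   same group: no choices are involved, in the sense that the construction is
   functorial under isomorphisms of quasi-actions.  An isomorphism
   (alpha, beta) induces an isometry of the associated spaces that is
   equivariant along alpha; its bijectivity follows from the functor laws
   [can_transport_id] and [can_transport_comp]. *)
Record canonicalIsometricAction (R : realType) := CanonicalIsometricAction {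
  can_space : quasiAction R -> metricType R;
  can_map : forall q : quasiAction R,
    qa_group q -> can_space q -> can_space q;
  can_mapP : forall q : quasiAction R, isometric_action (@can_map q);
  can_transport : forall (q r : quasiAction R)
    (alpha : qa_group q -> qa_group r) (beta : qa_space q -> qa_space r),
    qa_isomorphism alpha beta -> can_space q -> can_space r;
  can_transport_isometry : forall (q r : quasiAction R)
    (alpha : qa_group q -> qa_group r) (beta : qa_space q -> qa_space r)
    (i : qa_isomorphism alpha beta) (x y : can_space q),
    mdist (can_transport i x) (can_transport i y) = mdist x y;
  can_transport_equivariant : forall (q r : quasiAction R)
    (alpha : qa_group q -> qa_group r) (beta : qa_space q -> qa_space r)
    (i : qa_isomorphism alpha beta) (g : qa_group q) (x : can_space q),
    can_transport i (can_map g x) = can_map (alpha g) (can_transport i x);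
  can_transport_id : forall (q : quasiAction R)
    (i : @qa_isomorphism R q q id id) (x : can_space q),
    can_transport i x = x;
  can_transport_comp : forall (q r s : quasiAction R)
    (alpha : qa_group q -> qa_group r) (beta : qa_space q -> qa_space r)
    (alpha' : qa_group r -> qa_group s) (beta' : qa_space r -> qa_space s)
    (i : qa_isomorphism alpha beta) (j : qa_isomorphism alpha' beta')
    (k : qa_isomorphism (alpha' \o alpha) (beta' \o beta)) (x : can_space q),
    can_transport k x = can_transport j (can_transport i x) }.

(* Main.v *)
(** Let [G] act by left translation on the first factor of [G * X].  The
pseudometric [sup_k d(rho(k g) x, rho(k h) y)] between [(g, x)] and [(h, y)] is
invariant under this action, and finite because [rho(k g)] is within [A] of
[rho(k) rho(g)].  Its metric quotient is [X'], and [x |-> (1, x)] is the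
quasi-conjugacy, as [(g, x)] is at distance at most [A] from
[(1, rho(g) x)]. *)

Require Import Defs.
From HB Require Import structures.
From mathcomp Require Import all_boot all_order all_algebra.
From mathcomp Require Import all_classical all_reals all_analysis.
From mathcomp Require Import lra.

Set Implicit Arguments.
Unset Strict Implicit.
Unset Printing Implicit Defensive.

Import Order.TTheory GRing.Theory Num.Theory.

Local Open Scope ring_scope.
Local Open Scope quotient_scope.

(** * The metric quotient of a pseudometric *)

Record pseudometric (R : realType) (T : Type) := Pseudometric {
  pm_dist :> T -> T -> R;
  pm_distxx : forall x, pm_dist x x = 0;
  pm_dist_sym : forall x y, pm_dist x y = pm_dist y x;
  pm_dist_triangle : forall y x z, pm_dist x z <= pm_dist x y + pm_dist y z }.

Section metric_quotient.
Variables (R : realType) (T : choiceType) (d : pseudometric R T).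

Lemma pm_dist_ge0 x y : 0 <= d x y.
Proof.
by have := pm_dist_triangle d y x x; rewrite pm_distxx (pm_dist_sym d y x); lra.
Qed.

Definition indiscernible : rel T := fun x y => d x y == 0.

Lemma indiscernible_refl : reflexive indiscernible.
Proof. by move=> x; rewrite /indiscernible pm_distxx. Qed.

Lemma indiscernible_sym : symmetric indiscernible.
Proof. by move=> x y; rewrite /indiscernible pm_dist_sym. Qed.

Lemma indiscernible_trans : transitive indiscernible.
Proof.
move=> y x z /eqP xy /eqP yz; rewrite /indiscernible eq_le pm_dist_ge0 andbT.
by rewrite (le_trans (pm_dist_triangle d y x z))// xy yz addr0.
Qed.

Canonical indiscernible_equiv :=
  EquivRel indiscernible indiscernible_refl indiscernible_sym
    indiscernible_trans.

Definition metric_quotient : Type := {eq_quot indiscernible_equiv}.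

HB.instance Definition _ := Choice.on metric_quotient.

Definition mq_class (x : T) : metric_quotient :=
  \pi_{eq_quot indiscernible_equiv} x.

Definition mq_repr (u : metric_quotient) : T :=
  repr (u : {eq_quot indiscernible_equiv}).

Lemma mq_reprK : cancel mq_repr mq_class.
Proof. exact: reprK. Qed.

Lemma mq_classP x y : mq_class x = mq_class y <-> d x y = 0.
Proof.
split; first by move=> /eqmodP /eqP.
by move=> /eqP xy; apply/eqmodP.
Qed.

(** Evaluated at chosen representatives, so the metric axioms come straight from [d];
    [mdist_mq_class] shows that the choice does not affect the value. *)
Definition mq_dist (u v : metric_quotient) : R := d (mq_repr u) (mq_repr v).

Lemma mq_distxx u : mq_dist u u = 0.
Proof. exact: pm_distxx. Qed.

Lemma mq_dist_sym u v : mq_dist u v = mq_dist v u.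
Proof. exact: pm_dist_sym. Qed.

Lemma mq_dist_triangle v u w : mq_dist u w <= mq_dist u v + mq_dist v w.
Proof. exact: pm_dist_triangle. Qed.

Lemma mq_dist_positivity u v : mq_dist u v = 0 -> u = v.
Proof. by move=> /mq_classP; rewrite !mq_reprK. Qed.

HB.instance Definition _ := isMetric.Build R metric_quotient
  mq_distxx mq_dist_positivity mq_dist_sym mq_dist_triangle.

(** Each point is at distance 0 from the representative of its class, so moving both endpoints, one
    at a time, by the triangle inequality changes nothing in either direction. *)
Lemma mdist_mq_class x y :
  mdist (mq_class x : metric_quotient) (mq_class y) = d x y.
Proof.
have e z : d (mq_repr (mq_class z)) z = 0 by apply/mq_classP/mq_reprK.
have t := pm_dist_triangle d; have s := pm_dist_sym d.
rewrite /mdist/= /mq_dist; set x' := mq_repr _; set y' := mq_repr _.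
have := t x x' y'; have := t y x y'; have := t x' x y; have := t y' x' y.
rewrite (s x x') (s y y') !e => *; apply/eqP; rewrite eq_le; lra.
Qed.

End metric_quotient.

Section metric_quotient_map.
Variables (R : realType) (T T' : choiceType).
Variables (d : pseudometric R T) (d' : pseudometric R T').

(* Depends on the chosen representative unless [f] preserves distances. *)
Definition mq_map (f : T -> T') (u : metric_quotient d) : metric_quotient d' :=
  mq_class d' (f (mq_repr u)).

Lemma mq_map_class (f : T -> T') :
  (forall x y, d' (f x) (f y) = d x y) ->
  forall x, mq_map f (mq_class d x) = mq_class d' (f x).
Proof.
by move=> fd x; apply/mq_classP; rewrite fd; apply/mq_classP/mq_reprK.
Qed.

Lemma mdist_mq_map (f : T -> T') :
  (forall x y, d' (f x) (f y) = d x y) ->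
  forall u v, mdist (mq_map f u) (mq_map f v) = mdist u v.
Proof. by move=> fd u v; rewrite mdist_mq_class fd. Qed.

End metric_quotient_map.

Arguments mq_map {R T T' d d'} f u.

(** * The invariant pseudometric on [G * X] *)

Section orbit_distance.
Variables (R : realType) (q : quasiAction R).
Local Notation G := (qa_group q).
Local Notation X := (qa_space q).
Local Notation rho := (@qa_map R q).
Implicit Types a b c : G * X.

Definition orbit_gap a b (k : G) : R :=
  mdist (rho (k * a.1)%g a.2) (rho (k * b.1)%g b.2).

Definition orbit_dist a b : R := sup (range (orbit_gap a b)).

(** Follow the path [rho (k * g) x], [rho k (rho g x)], [rho k (rho h y)], [rho (k * h) y]. The
    outer legs cost [A] each, and the middle one is controlled by the upper bound for [rho k]. The
    result is uniform in [k]. *)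
Lemma orbit_gap_le (L A : R) : quasi_action L A rho ->
  forall a b k,
    orbit_gap a b k <= L * mdist (rho a.1 a.2) (rho b.1 b.2) + 3 * A.
Proof.
move=> [qi comp _] [g x] [h y] k; rewrite /orbit_gap/=.
have [_ _ _ up _] := qi k.
have := comp k g x; have := comp k h y; have := up (rho g x) (rho h y).
have := metric_triangle (rho (k * g)%g x) (rho k (rho g x)) (rho (k * h)%g y).
have := metric_triangle (rho k (rho g x)) (rho k (rho h y)) (rho (k * h)%g y).
rewrite (metric_sym (rho (k * g)%g x) (rho k (rho g x))); lra.
Qed.

(** This makes the real [sup] in [orbit_dist] a genuine supremum. The constants serve only to bound
    it and do not enter its value, so the distance depends on the quasi-action alone. *)
Lemma orbit_gap_bounded a b : has_ubound (range (orbit_gap a b)).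
Proof.
have [L [A /orbit_gap_le gap]] := qa_mapP q.
by exists (L * mdist (rho a.1 a.2) (rho b.1 b.2) + 3 * A) => _ [k _ <-].
Qed.

Lemma le_orbit_dist a b k : orbit_gap a b k <= orbit_dist a b.
Proof. by apply: ub_le_sup; [exact: orbit_gap_bounded | exists k]. Qed.

Lemma orbit_dist_le a b (M : R) :
  (forall k, orbit_gap a b k <= M) -> orbit_dist a b <= M.
Proof.
move=> gapM; apply: ge_sup; first by exists (orbit_gap a b 1%g), 1%g.
by move=> _ [k _ <-].
Qed.

Lemma orbit_distxx a : orbit_dist a a = 0.
Proof.
apply/eqP; rewrite eq_le orbit_dist_le => [|k]; last first.
  by rewrite /orbit_gap mdistxx.
by rewrite (le_trans _ (le_orbit_dist a a 1%g))// mdist_ge0.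
Qed.

Lemma orbit_dist_sym a b : orbit_dist a b = orbit_dist b a.
Proof.
suff e : orbit_gap a b = orbit_gap b a by rewrite /orbit_dist e.
by apply/funext => k; exact: metric_sym.
Qed.

Lemma orbit_dist_triangle b a c :
  orbit_dist a c <= orbit_dist a b + orbit_dist b c.
Proof.
apply: orbit_dist_le => k.
apply: le_trans (metric_triangle _ (rho (k * b.1)%g b.2) _) _.
exact: lerD (le_orbit_dist a b k) (le_orbit_dist b c k).
Qed.

Definition orbit_pseudometric : pseudometric R (G * X)%type :=
  Pseudometric orbit_distxx orbit_dist_sym orbit_dist_triangle.

Definition translate (g : G) a : G * X := ((g * a.1)%g, a.2).

(** Right multiplication by [g] permutes the indices [k], so both suprema run over the same set of
    gaps. *)
Lemma orbit_dist_translate g a b :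
  orbit_dist (translate g a) (translate g b) = orbit_dist a b.
Proof.
rewrite /orbit_dist; congr sup; apply/seteqP; split=> _ [k _ <-].
  by exists (k * g)%g => //; rewrite /orbit_gap/= !mulgA.
by exists (k * g^-1)%g => //; rewrite /orbit_gap/= !mulgA !mulgVK.
Qed.

End orbit_distance.

(** The gap at [alpha k] on the target equals the gap at [k] on the source, and [alpha] reaches
    every index. *)
Lemma orbit_dist_isomorphism (R : realType) (q r : quasiAction R)
    (alpha : qa_group q -> qa_group r) (beta : qa_space q -> qa_space r) :
  qa_isomorphism alpha beta ->
  forall a b, orbit_dist (alpha a.1, beta a.2) (alpha b.1, beta b.2) =
    orbit_dist a b.
Proof.
move=> [[alpha' alphaK alphaK'] alphaM _ betad equi] a b.
have gap k : orbit_gap (alpha a.1, beta a.2) (alpha b.1, beta b.2) (alpha k) =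
    orbit_gap a b k by rewrite /orbit_gap/= -!alphaM -!equi betad.
rewrite /orbit_dist; congr sup; apply/seteqP; split=> _ [k _ <-].
  by exists (alpha' k) => //; rewrite -gap alphaK'.
by exists (alpha k).
Qed.

(** * The canonical isometric action and its functoriality *)

Section orbit_space.
Variable R : realType.
Implicit Types q r s : quasiAction R.

Definition orbit_space q : metricType R :=
  metric_quotient (orbit_pseudometric q).

Definition orbit_action q (g : qa_group q) : orbit_space q -> orbit_space q :=
  mq_map (translate g).

Lemma orbit_actionP q : isometric_action (@orbit_action q).
Proof.
split=> [g u v|g h u|u].
- by rewrite mdist_mq_map//; exact: orbit_dist_translate.
(* Only the inner map is unfolded: the outer one then acts on an explicit class, which avoids a
   second choice of representative. *)
- rewrite /orbit_action {2}/mq_map mq_map_class; last first.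
    exact: orbit_dist_translate.
  by rewrite /mq_map /translate/= mulgA.
- rewrite -[RHS]mq_reprK /orbit_action /mq_map /translate mul1g.
  by rewrite -surjective_pairing.
Qed.

Definition orbit_transport q r (alpha : qa_group q -> qa_group r)
    (beta : qa_space q -> qa_space r) (i : qa_isomorphism alpha beta) :
    orbit_space q -> orbit_space r :=
  mq_map (fun a => (alpha a.1, beta a.2)).

Lemma orbit_transport_isometry q r (alpha : qa_group q -> qa_group r)
    (beta : qa_space q -> qa_space r) (i : qa_isomorphism alpha beta) u v :
  mdist (orbit_transport i u) (orbit_transport i v) = mdist u v.
Proof. by rewrite mdist_mq_map//; exact: orbit_dist_isomorphism. Qed.

Lemma orbit_transport_equivariant q r (alpha : qa_group q -> qa_group r)
    (beta : qa_space q -> qa_space r) (i : qa_isomorphism alpha beta) g u :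
  orbit_transport i (orbit_action g u) =
  orbit_action (alpha g) (orbit_transport i u).
Proof.
have [_ alphaM _ _ _] := i.
rewrite /orbit_action /orbit_transport {2 4}/mq_map !mq_map_class.
- by rewrite /translate/= alphaM.
- exact: orbit_dist_translate.
- exact: orbit_dist_isomorphism.
Qed.

Lemma orbit_transport_id q (i : @qa_isomorphism R q q id id) u :
  orbit_transport i u = u.
Proof.
by rewrite -[RHS]mq_reprK /orbit_transport /mq_map -surjective_pairing.
Qed.

Lemma orbit_transport_comp q r s
    (alpha : qa_group q -> qa_group r) (beta : qa_space q -> qa_space r)
    (alpha' : qa_group r -> qa_group s) (beta' : qa_space r -> qa_space s)
    (i : qa_isomorphism alpha beta) (j : qa_isomorphism alpha' beta')
    (k : qa_isomorphism (alpha' \o alpha) (beta' \o beta)) u :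
  orbit_transport k u = orbit_transport j (orbit_transport i u).
Proof.
rewrite /orbit_transport {3}/mq_map mq_map_class//.
exact: orbit_dist_isomorphism.
Qed.

Definition orbit_construction : canonicalIsometricAction R :=
  CanonicalIsometricAction orbit_actionP orbit_transport_isometry
    orbit_transport_equivariant orbit_transport_id orbit_transport_comp.

(** * The quasi-conjugacy *)

Definition orbit_embedding q (x : qa_space q) : orbit_space q :=
  mq_class (orbit_pseudometric q) (1%g, x).

(** The gap at [k] is the distance from [rho k (rho g x)] to [rho (k * g) x], which is the
    composition defect of the quasi-action. *)
Lemma orbit_embedding_near q (L A : R) : quasi_action L A (@qa_map R q) ->
  forall g x,
    mdist (orbit_embedding (qa_map g x))
      (mq_class (orbit_pseudometric q) (g, x) : orbit_space q) <= A.
Proof.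
move=> [_ comp _] g x; rewrite mdist_mq_class; apply: orbit_dist_le => k.
by rewrite /orbit_gap/= mulg1.
Qed.

(** Each estimate below is obtained with error [A] and relaxed to [3 * A] using [0 <= A]. *)
Lemma orbit_embedding_quasi_isometry q (L A : R) :
  quasi_action L A (@qa_map R q) ->
  quasi_isometry L (3 * A) (@orbit_embedding q).
Proof.
move=> rhoP; have [qi _ _] := rhoP.
have [L1 A0 _ _ _] := qi 1%g; split=> //; first lra.
- move=> x y; rewrite mdist_mq_class.
  (* A single index bounds the supremum from below; at [k = 1] the gap is bounded below because
     [rho 1] is a quasi-isometry. *)
  apply: le_trans (le_orbit_dist _ _ 1%g); rewrite /orbit_gap/= mulg1.
  by have [_ _ lo _ _] := qi 1%g; have := lo x y; lra.
- move=> x y; rewrite mdist_mq_class; apply: orbit_dist_le => k.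
  rewrite /orbit_gap/= mulg1.
  by have [_ _ _ up _] := qi k; have := up x y; lra.
(* The class of [(g, x)] is approximated by the image of [rho g x]. *)
- move=> u; exists (qa_map (mq_repr u).1 (mq_repr u).2).
  have := orbit_embedding_near rhoP (mq_repr u).1 (mq_repr u).2.
  rewrite metric_sym -surjective_pairing mq_reprK => /le_trans; apply; lra.
Qed.

(** Translating [(1, x)] by [g] gives [(g, x)], so the equivariance defect is exactly the distance
    bounded in [orbit_embedding_near]. *)
Lemma orbit_embedding_quasi_conjugate q (L A : R) :
  quasi_action L A (@qa_map R q) ->
  quasi_conjugate L (3 * A) (@qa_map R q) (@orbit_action q).
Proof.
move=> rhoP; exists (@orbit_embedding q).
  exact: orbit_embedding_quasi_isometry.
exists A => g x; rewrite /orbit_action mq_map_class; last first.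
  exact: orbit_dist_translate.
by rewrite /translate/= mulg1; exact: (orbit_embedding_near rhoP).
Qed.

End orbit_space.

Theorem corollary1p4 (R : realType) :
  exists F : canonicalIsometricAction R,
    forall (G : groupType) (X : metricType R) (rho : G -> X -> X) (L A : R)
      (rhoP : quasi_action L A rho),
      quasi_conjugate L (3 * A) rho
        (@can_map R F
           (QuasiAction (ex_intro _ L (ex_intro _ A rhoP)))).
Proof.
exists (orbit_construction R) => G X rho L A rhoP.
exact: (@orbit_embedding_quasi_conjugate R (QuasiAction _)).
Qed.
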